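(* Let $(R,\,S\subseteq R_1)$ be a good $\mathbb{C}$-algebra. Let $M$ be a finitely-generated graded left $R$-module. Then there exists an integer-valued polynomial $P_M(x)\in\mathbb{Q}[x]$ of degree $\deg P_M<|S|$ such that $$\dim_{\mathbb{C}} M_n=P_M(n)$$ for all sufficiently large $n$.
   Context: Gradings are over $\mathbb{N}=\{0,1,2,\dots\}$. A good $\mathbb{C}$-algebra $(R,S)$ consists of a graded (associative, unital, not necessarily commutative), left Noetherian $\mathbb{C}$-algebra $R=\bigoplus_{n\ge0}R_n$ together with a finite set $S\subseteq R_1$ of elements of degree $1$ that generates $R$ as a $\mathbb{C}$-algebra and satisfies $sR=Rs$ for all $s\in S$. A polynomial $P\in\mathbb{Q}[x]$ is integer-valued if $P(\mathbb{Z})\subseteq\mathbb{Z}$. The zero polynomial is regarded as having degree $<0$. *)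

(* Defs.v *)
From HB Require Import structures.
From mathcomp Require Import all_boot all_order all_algebra.
From mathcomp Require Import finmap.
From mathcomp Require Import classical_sets reals complex.

Set Implicit Arguments.
Unset Strict Implicit.
Unset Printing Implicit Defensive.

Import GRing.Theory.
Local Open Scope ring_scope.

(* V is the internal direct sum of its additive subgroups V_ 0, V_ 1, ... *)
Definition is_direct_sum (V : zmodType) (V_ : nat -> {pred V}) : Prop :=
  [/\ forall n, zmod_closed (V_ n),
      forall v : V, exists (N : nat) (c : nat -> V),
        (forall i, c i \in V_ i) /\ v = \sum_(i < N) c i
    & forall (N : nat) (c : nat -> V), (forall i, c i \in V_ i) ->
        \sum_(i < N) c i = 0 -> forall i, (i < N)%N -> c i = 0].

(* Ascending chain condition on left ideals: these are the submodules of the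
   left regular module R^o. *)
Definition left_noetherian (R : pzRingType) : Prop :=
  forall I : nat -> {pred R^o},
    (forall n, submod_closed (I n)) ->
    (forall n, {subset I n <= I n.+1}) ->
    exists N, forall n, (N <= n)%N -> I n =i I N.

Definition finitely_generated (R : pzRingType) (M : lmodType R) : Prop :=
  exists g : seq M, forall m : M,
    exists a : nat -> R, m = \sum_(i < size g) a i *: g`_i.

(* An F-algebra is given by its structure map eta : F -> R, with central image.
   This is used instead of algType, which excludes the zero algebra. *)
Definition is_algebra (F : fieldType) (R : pzRingType)
    (eta : {rmorphism F -> R}) : Prop :=
  forall (k : F) (x : R), eta k * x = x * eta k.

Record graded_algebra (F : fieldType) (R : pzRingType)
    (eta : {rmorphism F -> R}) (R_ : nat -> {pred R}) : Prop := GradedAlgebra {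
  graded_algebra_alg : is_algebra eta;
  graded_algebra_sum : is_direct_sum R_;
  graded_algebra_scale : forall n (k : F) (x : R),
    x \in R_ n -> eta k * x \in R_ n;
  graded_algebra1 : 1 \in R_ 0%N;
  graded_algebraM : forall m n (x y : R),
    x \in R_ m -> y \in R_ n -> x * y \in R_ (m + n)%N
}.

(* Every F-subalgebra of R containing S is all of R. *)
Definition generates_algebra (F : fieldType) (R : pzRingType)
    (eta : {rmorphism F -> R}) (S : {fset R}) : Prop :=
  forall A : {pred R}, subring_closed A -> (forall k : F, eta k \in A) ->
    (forall s, s \in S -> s \in A) -> forall x : R, x \in A.

Record good_algebra (F : fieldType) (R : pzRingType)
    (eta : {rmorphism F -> R}) (R_ : nat -> {pred R}) (S : {fset R}) : Prop :=
  GoodAlgebra {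
  good_graded : graded_algebra eta R_;
  good_noetherian : left_noetherian R;
  good_degree1 : forall s, s \in S -> s \in R_ 1%N;
  good_generates : generates_algebra eta S;
  good_normal : forall s, s \in S ->
    range (fun r : R => s * r) = range (fun r : R => r * s)
}.

(* The graded pieces are F-subspaces of M: they are stable under R_ 0, which
   contains the image of F. *)
Record graded_module (R : pzRingType) (R_ : nat -> {pred R})
    (M : lmodType R) (M_ : nat -> {pred M}) : Prop := GradedModule {
  graded_module_sum : is_direct_sum M_;
  graded_moduleZ : forall i j (r : R) (m : M),
    r \in R_ i -> m \in M_ j -> r *: m \in M_ (i + j)%N
}.

(* U has an F-basis with d elements, where F acts on M through eta. *)
Definition has_dim (F : fieldType) (R : pzRingType) (eta : {rmorphism F -> R})
    (M : lmodType R) (U : {pred M}) (d : nat) : Prop :=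
  exists b : 'I_d -> M,
    [/\ forall i, b i \in U,
        forall k : 'I_d -> F,
          \sum_(i < d) eta (k i) *: b i = 0 -> forall i, k i = 0
      & forall m, m \in U ->
          exists k : 'I_d -> F, m = \sum_(i < d) eta (k i) *: b i].

Definition integer_valued (P : {poly rat}) : Prop :=
  forall z : int, P.[z%:~R] \is a Num.int.

(* Main.v *)
Require Import Defs.
From HB Require Import structures.
From mathcomp Require Import all_boot all_order all_algebra.
From mathcomp Require Import finmap.
From mathcomp Require Import boolp classical_sets reals complex.
From mathcomp Require Import ring.

Set Implicit Arguments.
Unset Strict Implicit.
Unset Printing Implicit Defensive.

Import GRing.Theory.
Local Open Scope classical_set_scope.
Local Open Scope ring_scope.

(* Hilbert's argument, by induction on the number of elements of S that do not
   annihilate the module: for s in S, multiplication by s gives exact sequences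
   0 -> K_n -> M_n -> M_(n+1) -> (M/sM)_(n+1) -> 0, where K and sM are graded
   submodules because sR = Rs, and both K and M/sM are annihilated by s.  So
   dim M_(n+1) - dim M_n is eventually a polynomial in n, and its sum is one of
   degree one more.  If all of S annihilates the module then R acts through
   scalars, so the module is finite-dimensional.  Quotients are avoided by
   running the induction on subquotients L/N of the fixed module M. *)

(** * Sums of sets, submodules and spans *)

Definition sumset (V : zmodType) (A B : set V) : set V :=
  [set m | exists u v, [/\ A u, B v & m = u + v]].

Lemma sumsetl (V : zmodType) (A B : set V) : B 0 -> A `<=` sumset A B.
Proof. by move=> B0 m Am; exists m, 0; rewrite addr0. Qed.

Lemma sumsetr (V : zmodType) (A B : set V) : A 0 -> B `<=` sumset A B.
Proof. by move=> A0 m Bm; exists 0, m; rewrite add0r. Qed.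

Section Submodules.
Variables (R : pzRingType) (V : lmodType R).
Implicit Types (A B : set V) (g : seq V).

(** Stated over an arbitrary ring, so as to cover left ideals of [R], submodules of [M], and the
    graded pieces as subspaces over [F]. *)
Definition submodule A := A 0 /\ forall a u v, A u -> A v -> A (a *: u + v).

Lemma submoduleD A u v : submodule A -> A u -> A v -> A (u + v).
Proof. by move=> [_ cA] Au Av; rewrite -[u]scale1r; apply: cA. Qed.

Lemma submoduleZ A a u : submodule A -> A u -> A (a *: u).
Proof. by move=> [A0 cA] Au; rewrite -[a *: u]addr0; apply: cA. Qed.

Lemma submoduleB A u v : submodule A -> A u -> A v -> A (u - v).
Proof.
by move=> sA Au Av; rewrite -scaleN1r; apply: submoduleD => //; apply: submoduleZ.
Qed.

Lemma submodule_sum A (sA : submodule A) (I : Type) (r : seq I) (P : pred I)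
    (f : I -> V) :
  (forall i, P i -> A (f i)) -> A (\sum_(i <- r | P i) f i).
Proof.
move=> Af; elim/big_ind: _ => //; first by case: sA.
by move=> u v; apply: submoduleD.
Qed.

Lemma submodule_sumset A B :
  submodule A -> submodule B -> submodule (sumset A B).
Proof.
move=> sA sB; split.
  by exists 0, 0; rewrite addr0; split=> //; [case: sA | case: sB].
move=> a _ _ [u1 [v1 [Au1 Bv1 ->]]] [u2 [v2 [Au2 Bv2 ->]]].
exists (a *: u1 + u2), (a *: v1 + v2); split.
- by case: sA => _; apply.
- by case: sB => _; apply.
- by rewrite scalerDr addrACA.
Qed.

Definition span g : set V :=
  [set m | exists a : nat -> R, m = \sum_(i < size g) a i *: g`_i].

Lemma span_nil : span [::] = [set 0].
Proof.
apply/seteqP; split=> m /=; first by move=> [a ->]; rewrite big_ord0.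
by move=> ->; exists (fun=> 0); rewrite big_ord0.
Qed.

Lemma span_cons x g :
  span (x :: g) = [set m | exists a u, span g u /\ m = a *: x + u].
Proof.
apply/seteqP; split=> m /=.
  move=> [a ->]; rewrite big_ord_recl /=.
  by exists (a 0%N), (\sum_(i < size g) a i.+1 *: g`_i); split=> //; exists (a \o S).
move=> [a [_ [[c ->] ->]]]; exists (fun n => if n is n'.+1 then c n' else a).
by rewrite big_ord_recl.
Qed.

Lemma submodule_span g : submodule (span g).
Proof.
split; first by exists (fun=> 0); rewrite big1 // => i _; rewrite scale0r.
move=> a _ _ [b ->] [c ->]; exists (fun i => a * b i + c i).
rewrite scaler_sumr -big_split /=; apply: eq_bigr => i _.
by rewrite scalerDl scalerA.
Qed.

Lemma mem_span g x : x \in g -> span g x.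
Proof.
elim: g => // y g IH; rewrite inE span_cons => /orP[/eqP->|/IH gx] /=.
  by exists 1, 0; rewrite scale1r addr0; split=> //; case: (submodule_span g).
by exists 0, x; rewrite scale0r add0r.
Qed.

Lemma span_sub A g : submodule A -> (forall x, x \in g -> A x) -> span g `<=` A.
Proof.
move=> sA gA _ [a ->]; apply: submodule_sum => // i _.
by apply: submoduleZ => //; apply/gA/mem_nth.
Qed.

End Submodules.

(** * Finite generation over a left Noetherian ring *)

Section Noetherian.
Variable R : pzRingType.
Hypothesis R_noeth : left_noetherian R.

(** If no finite list in [I] spanned it, adjoining again and again an element of [I] outside the
    current span would give a chain of left ideals that never stabilizes. *)
Lemma left_ideal_fg (I : set R^o) : submodule I ->
  exists g : seq R^o, (forall x, x \in g -> I x) /\ I `<=` span g.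
Proof.
move=> sI; apply: contrapT => nfg.
(* The hypothesis on [g] sits under the existential, with a dummy [x] when it fails, so that
   [choice] gives a total function. *)
have next (g : seq R^o) : exists x, (forall y, y \in g -> I y) ->
    I x /\ ~ span g x.
  have [gI|ngI] := pselect (forall y, y \in g -> I y); last by exists 0.
  have [x nx] : exists x, ~ (I x -> span g x).
    by apply/existsNP => sub; apply: nfg; exists g.
  by exists x => _; apply/not_implyP.
have [nx nxP] := choice next.
pose gs n := iter n (fun g => nx g :: g) [::].
have gsI n : forall y, y \in gs n -> I y.
  elim: n => // n IH y; rewrite inE => /orP[/eqP->|/IH//].
  by case: (nxP _ IH).
have [//|n x|N] := R_noeth (I := fun n => [pred x | `[< span (gs n) x >]]) .
- move=> n; split; first by apply/asboolP; case: (submodule_span (gs n)).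
  move=> a u v /asboolP su /asboolP sv; apply/asboolP.
  by case: (submodule_span (gs n)) => _; apply.
- move=> /asboolP sx; apply/asboolP; apply: span_sub sx => [|y gy].
    exact: submodule_span.
  by apply: mem_span; rewrite inE gy orbT.
move=> /(_ N.+1 (leqnSn N) (nx (gs N))).
have [_ /asboolPn] := nxP _ (@gsI N); rewrite !inE => /negbTE ->.
by move/asboolP; apply; apply: mem_span; rewrite inE eqxx.
Qed.

(* Induction on the number of generators: the elements of [A] with no
   component on the first generator, and a left ideal of first components. *)
Lemma submodule_span_fg (M : lmodType R) (g : seq M) (A : set M) :
  submodule A -> A `<=` span g ->
  exists h : seq M, (forall x, x \in h -> A x) /\ A `<=` span h.
Proof.
elim: g A => [|x g IH] A sA; first by rewrite span_nil => A0; exists [::]; rewrite span_nil.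
rewrite span_cons => Ag.
have [h [hA hP]] : exists h : seq M, (forall x, x \in h -> (A `&` span g) x) /\
    A `&` span g `<=` span h.
  apply: IH => [|m []//]; split; first by split; [case: sA|case: (submodule_span g)].
  by move=> a u v [Au gu] [Av gv]; split; [case: sA|case: (submodule_span g)] => _; apply.
pose I : set R^o := [set r | exists u, span g u /\ A (r *: x + u)].
have sI : submodule I.
  split; first by exists 0; rewrite scale0r add0r; split; [case: (submodule_span g)|case: sA].
  move=> a r1 r2 [u1 [g1 A1]] [u2 [g2 A2]]; exists (a *: u1 + u2); split.
    by case: (submodule_span g) => _; apply.
  rewrite scalerDl addrACA -scalerA -scalerDr.
  by case: sA => _; apply.
have [k [kI kP]] := left_ideal_fg sI.
have /choice[f fP] (r : R^o) : exists u, I r -> span g u /\ A ((r : R) *: x + u).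
  by have [[u ?]|nI] := pselect (I r); [exists u|exists 0].
pose l := [seq (r : R) *: x + f r | r <- k].
have lA y : y \in l -> A y by move=> /mapP[r /kI /fP[_ ?] ->].
exists (l ++ h); split=> [y|m Am].
  by rewrite mem_cat => /orP[/lA//|/hA[]].
have [r [u [gu mE]]] := Ag _ Am.
have /kP[a rE] : I r by exists u; rewrite -mE.
(* [w] has the same coefficient [r] on [x] as [m], so [m - w] falls in [span g], where [h] takes
   over. *)
pose w := \sum_(i < size k) a i *: ((k`_i : R) *: x + f k`_i).
have wl : span (l ++ h) w.
  apply: submodule_sum => [|i _]; first exact: submodule_span.
  apply: submoduleZ; first exact: submodule_span.
  apply: mem_span; rewrite mem_cat; apply/orP; left; apply/map_f/mem_nth.
  exact: ltn_ord.
have Aw : A w.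
  apply: submodule_sum => // i _; apply: submoduleZ => //.
  by have [] := fP _ (kI _ (mem_nth 0 (ltn_ord i))).
rewrite -[m](subrK w); apply: submoduleD => //; first exact: submodule_span.
have : (A `&` span g) (m - w).
  split; first exact: submoduleB.
  have -> : m - w = u - \sum_(i < size k) a i *: f k`_i.
    have -> : w = r *: x + \sum_(i < size k) a i *: f k`_i.
      rewrite {}rE scaler_suml -big_split /=; apply: eq_bigr => i _.
      by rewrite scalerDr scalerA.
    by rewrite mE opprD addrACA subrr add0r.
  apply: submoduleB => //; first exact: submodule_span.
  apply: submodule_sum => [|i _]; first exact: submodule_span.
  apply: submoduleZ; first exact: submodule_span.
  by have [] := fP _ (kI _ (mem_nth 0 (ltn_ord i))).
move=> /hP; apply: span_sub => [|y hy]; first exact: submodule_span.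
by apply: mem_span; rewrite mem_cat hy orbT.
Qed.

End Noetherian.

(** * Dimensions of quotients of vector spaces *)

Section RelativeDimension.
Variables (F : fieldType) (V : lmodType F).
Implicit Types (W U T : set V).

(* [U / W] has dimension [d]; this is meant for subspaces [W] of [U]. *)
Definition rdim W U d := exists b : 'I_d -> V,
  [/\ forall i, U (b i),
      forall k : 'I_d -> F, W (\sum_i k i *: b i) -> forall i, k i = 0
    & forall u, U u -> exists k : 'I_d -> F, W (u - \sum_i k i *: b i)].

Lemma rdim_refl W : rdim W W 0.
Proof.
exists (fun=> 0); split=> [[]//|k _ []//|u Wu].
by exists (fun=> 0); rewrite big_ord0 subr0.
Qed.

(** A basis of [U / W] followed by one of [T / U] is a basis of [T / W]. *)
Lemma rdim_trans W U T d e : submodule U -> W `<=` U -> U `<=` T ->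
  rdim W U d -> rdim U T e -> rdim W T (d + e).
Proof.
move=> sU WU UT [b [bU bI bS]] [c [cT cI cS]].
pose bc i := match split i with inl j => b j | inr j => c j end.
have bcE k : \sum_i k i *: bc i =
    \sum_i k (lshift e i) *: b i + \sum_i k (rshift d i) *: c i.
  rewrite big_split_ord /=; congr (_ + _); apply: eq_bigr => i _.
    by rewrite /bc (unsplitK (inl _ i)).
  by rewrite /bc (unsplitK (inr _ i)).
have bUk k : U (\sum_i k i *: b i).
  by apply: submodule_sum => // i _; apply: submoduleZ.
exists bc; split.
- by move=> i; rewrite /bc; case: split => j //; apply: UT.
- move=> k; rewrite bcE => Wk.
  have kr : forall i, k (rshift d i) = 0.
    apply: (cI (fun i => k (rshift d i))).
    set x := (X in W (X + _)) in Wk; rewrite -[\sum_i _](addKr x).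
    by rewrite addrC; apply: submoduleB => //; [exact: WU|exact: bUk].
  have kl : forall i, k (lshift e i) = 0.
    apply: (bI (fun i => k (lshift e i))).
    by rewrite [X in _ + X]big1 ?addr0 in Wk => // i _; rewrite kr scale0r.
  by move=> i; rewrite -(splitK i); case: split => j /=.
- move=> t /cS[kc /bS[kb Wt]].
  exists (fun i => match split i with inl j => kb j | inr j => kc j end).
  rewrite bcE [X in W (t - X)](_ : _ = \sum_i kb i *: b i + \sum_i kc i *: c i).
    by rewrite opprD [- _ - _]addrC addrA.
  by congr (_ + _); apply: eq_bigr => i _;
    rewrite ?(unsplitK (inl _ i)) ?(unsplitK (inr _ i)).
Qed.


(** Let the matrix [A] express [b] through [c] modulo [W]. A relation between its rows is a relation
    between the [b i] modulo [W], so the rows are independent and the rank bounds [d] by [e]. *)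
Lemma rdim_leq W U d e : submodule W -> rdim W U d -> rdim W U e -> (d <= e)%N.
Proof.
move=> sW [b [bU bI _]] [c [_ _ cS]].
have /choice[k kP] i : exists k : 'I_e -> F, W (b i - \sum_j k j *: c j).
  exact: cS.
pose A : 'M[F]_(d, e) := \matrix_(i, j) k i j.
suff /eqP <- : row_free A by apply: rank_leq_col.
apply: inj_row_free => v vA; apply/rowP => i; rewrite mxE.
apply: (bI (v 0)).
have -> : \sum_i v 0 i *: b i = \sum_i v 0 i *: (b i - \sum_j k i j *: c j).
  under [RHS]eq_bigr do rewrite scalerBr.
  rewrite sumrB [X in _ - X](_ : _ = 0) ?subr0 //.
  under eq_bigr do rewrite scaler_sumr.
  rewrite exchange_big big1 //= => j _.
  have /rowP/(_ j) := vA; rewrite !mxE => vAj.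
  rewrite -[RHS](scale0r (c j)) -{}vAj scaler_suml.
  by apply: eq_bigr => l _; rewrite mxE scalerA.
by apply: submodule_sum => // l _; apply: submoduleZ.
Qed.

Lemma rdim_uniq W U d e : submodule W -> rdim W U d -> rdim W U e -> d = e.
Proof. by move=> sW Ud Ue; apply/eqP; rewrite eqn_leq !(rdim_leq sW Ud, rdim_leq sW Ue). Qed.

(** Each new generator either lies in the space reached so far or raises the dimension by exactly
    one. *)
Lemma rdim_span W g : submodule W -> exists d, rdim W (sumset W (span g)) d.
Proof.
move=> sW; elim: g => [|x g [d IH]].
  exists 0%N; rewrite span_nil (_ : sumset _ _ = W); first exact: rdim_refl.
  apply/seteqP; split=> [_ [u [_ [Wu -> ->]]]|u Wu]; first by rewrite addr0.
  by exists u, 0; rewrite addr0.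
set U := sumset W (span g) in IH *; set T := sumset W _.
have sU : submodule U by apply: submodule_sumset => //; apply: submodule_span.
have TE : T = [set m | exists a u, U u /\ m = a *: x + u].
  apply/seteqP; split=> m.
    move=> [u [v [Wu]]]; rewrite span_cons => -[a [w [gw ->]]] ->.
    by exists a, (u + w); rewrite addrCA; split=> //; exists u, w.
  move=> [a [_ [[w [v [Ww gv ->]]] ->]]]; exists w, (a *: x + v).
  by rewrite addrCA span_cons; split=> //; exists a, v.
have UT : U `<=` T by move=> u Uu; rewrite TE; exists 0, u; rewrite scale0r add0r.
have WU : W `<=` U by apply: sumsetl; case: (submodule_span g).
have [Ux|nUx] := pselect (U x).
  exists d; rewrite (_ : T = U) //; apply/seteqP; split=> // m; rewrite TE.
  by move=> [a [u [Uu ->]]]; case: sU => _; apply.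
exists (d + 1)%N; apply: rdim_trans WU UT IH _ => //.
exists (fun=> x); split.
- by move=> _; rewrite TE; exists 1, 0; rewrite scale1r addr0; split=> //; case: sU.
- move=> k; rewrite big_ord1 => Ukx i; rewrite (ord1 i).
  apply: contrapT => /eqP k0; apply: nUx.
  by rewrite -[x](scalerK k0); apply: submoduleZ.
- by move=> t; rewrite TE => -[a [u [Uu ->]]]; exists (fun=> a); rewrite big_ord1 addrAC subrr add0r.
Qed.

Lemma rdim_fg W U g : submodule W -> submodule U -> W `<=` U ->
  (forall x, x \in g -> U x) -> U `<=` sumset W (span g) -> exists d, rdim W U d.
Proof.
move=> sW sU WU gU Ug; have [d gd] := rdim_span g sW; exists d.
rewrite (_ : U = sumset W (span g)) //; apply/seteqP; split=> // _ [u [v [/WU Uu gv ->]]].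
by apply: submoduleD => //; apply: span_sub gv.
Qed.

(** A basis of [T] modulo [W] still spans [T] modulo the larger [U]. *)
Lemma rdim_quotient W U T d : submodule W -> submodule U -> submodule T ->
  W `<=` U -> U `<=` T -> rdim W T d -> exists e, rdim U T e.
Proof.
move=> sW sU sT WU UT [b [bT _ bS]].
apply: (@rdim_fg _ _ [seq b i | i <- enum 'I_d]) => // [_ /mapP[i _ ->]//|t /bS[k Wk]].
exists (t - \sum_i k i *: b i), (\sum_i k i *: b i); rewrite subrK; split=> //.
  exact: WU.
apply: submodule_sum => [|i _]; first exact: submodule_span.
apply: submoduleZ; first exact: submodule_span.
by apply/mem_span/map_f; rewrite mem_enum.
Qed.


(** First isomorphism theorem: [f] carries a basis of [U] modulo the preimage of [W'] to a basis of
    [W' + f(U)] modulo [W']. *)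
Lemma rdim_image (f : {linear V -> V}) U W' d :
  submodule W' -> rdim (U `&` f @^-1` W') U d -> submodule U ->
  rdim W' (sumset W' (f @` U)) d.
Proof.
move=> sW' [b [bU bI bS]] sU.
have fE (k : 'I_d -> F) : f (\sum_i k i *: b i) = \sum_i k i *: f (b i).
  by rewrite linear_sum; apply: eq_bigr => i _; rewrite linearZ.
exists (f \o b); split.
- by move=> i; apply: sumsetr; [case: sW'|exists (b i)].
- move=> k; rewrite -fE => Wk; apply: bI; split=> //.
  by apply: submodule_sum => // i _; apply: submoduleZ.
- move=> _ [w [_ [W'w [u Uu <-] ->]]]; have [k [_ /= W'k]] := bS _ Uu.
  exists k; rewrite -fE -addrA -linearB.
  exact: submoduleD.
Qed.

End RelativeDimension.

(** * Summation of integer-valued polynomials *)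

(** Induction on the size bound: the difference of [T] has degree at most [n] and the same
    coefficient of ['X^n] as [Q], so subtracting it from [Q] lowers the bound. *)
Lemma poly_antidifference n (Q : {poly rat}) : (size Q <= n)%N ->
  exists2 P : {poly rat}, (size P <= n.+1)%N & P \Po ('X + 1) - P = Q.
Proof.
elim: n Q => [|n IH] Q.
  rewrite leqn0 size_poly_eq0 => /eqP->.
  by exists 0; rewrite ?size_poly0 // comp_poly0 subr0.
move=> Qn; pose T := (Q`_n / n.+1%:R) *: 'X^(n.+1) : {poly rat}.
have [|P Pn PE] := IH (Q - (T \Po ('X + 1) - T)).
  apply/leq_sizeP => i ni.
  rewrite comp_polyZ comp_Xn_poly exprD1n -scalerBr coefB coefZ coefB coef_sum.
  under eq_bigr do rewrite coefMn coefXn.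
  rewrite coefXn big_ord_recr /= big_ord_recr /= binn mulr1n binSn.
  rewrite big1 ?add0r; last first.
    by move=> j _; rewrite gtn_eqF ?mul0rn // (leq_trans (ltn_ord j)).
  rewrite addrK; case: (eqVneq i n) => [->|in_].
    by rewrite mulfVK ?subrr // Num.Theory.pnatr_eq0.
  rewrite mul0rn mulr0 subr0; apply/(leq_sizeP _ _ Qn).
  by rewrite ltn_neqAle eq_sym in_.
exists (P + T); last by rewrite comp_polyD opprD addrACA PE subrK.
rewrite (leq_trans (size_polyD _ _)) // geq_max (leq_trans Pn) //=.
by rewrite (leq_trans (size_scale_leq _ _)) // size_polyXn.
Qed.

Lemma poly_summation k (Q : {poly rat}) (d : nat -> nat) n0 :
  integer_valued Q -> (size Q <= k)%N ->
  (forall n, (n0 <= n)%N -> (d n.+1)%:R = (d n)%:R + Q.[n%:R]) ->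
  exists P : {poly rat}, [/\ integer_valued P, (size P <= k.+1)%N
    & forall n, (n0 <= n)%N -> (d n)%:R = P.[n%:R]].
Proof.
move=> Qint Qk dE; have [P0 P0k P0E] := poly_antidifference Qk.
(* An antidifference may be changed by a constant, chosen here to make [P] agree with [d] at
   [n0]. *)
pose P := P0 + ((d n0)%:R - P0.[n0%:R])%:P.
have PS x : P.[x + 1] = P.[x] + Q.[x].
  have X1 : ('X + 1 : {poly rat}).[x] = x + 1 by rewrite !hornerE.
  by rewrite -P0E /P !hornerD hornerN !hornerC horner_comp X1; ring.
have P_n0 : P.[n0%:R] = (d n0)%:R by rewrite /P hornerD hornerC addrC subrK.
exists P; split.
(* [P] is an integer at [n0] and its increments are values of [Q], so integrality spreads from [n0]
   in both directions. *)
- have int_up (z : int) : P.[z%:~R] \is a Num.int -> P.[(z + 1)%:~R] \is a Num.int.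
    by move=> Pz; rewrite rmorphD /= PS rpredD.
  have int_down (z : int) : P.[z%:~R] \is a Num.int -> P.[(z - 1)%:~R] \is a Num.int.
    by rewrite -{1}[z](subrK 1) rmorphD /= PS => Pz; rewrite -(rpredDr _ (Qint (z - 1))).
  move=> z; rewrite -[z](subrK n0%:Z) addrC.
  elim/int_rect: (z - n0%:Z) => [|m IHm|m IHm].
  + by rewrite addr0 -pmulrn P_n0 rpred_nat.
  + by rewrite intS addrCA addrC; exact: int_up.
  + by rewrite intS opprD addrCA addrC; exact: int_down.
- rewrite (leq_trans (size_polyD _ _)) // geq_max P0k /=.
  by rewrite (leq_trans (size_polyC_leq1 _)).
- move=> n /subnK <-; elim: (n - n0)%N => [|m IH]; first by rewrite P_n0.
  by rewrite addSn dE ?leq_addl // IH -PS natr1.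
Qed.

(** * Homogeneous components *)

Section DirectSum.
Variables (V : zmodType) (V_ : nat -> {pred V}).
Hypothesis sumV : is_direct_sum V_.

(** Making [c] vanish from [N] on renders it independent of [N], hence determined by [v]. *)
Definition decomposition (v : V) (N : nat) (c : nat -> V) :=
  [/\ forall i, c i \in V_ i, forall i, (N <= i)%N -> c i = 0
    & v = \sum_(i < N) c i].

Lemma zero_in_piece n : 0 \in V_ n.
Proof. by case: sumV => /(_ n)[]. Qed.

Lemma pieceB n u v : u \in V_ n -> v \in V_ n -> u - v \in V_ n.
Proof. by case: sumV => /(_ n)[_ cV] _ _; apply: cV. Qed.

Lemma pieceD n u v : u \in V_ n -> v \in V_ n -> u + v \in V_ n.
Proof.
by move=> Vu Vv; rewrite -[v]opprK pieceB // -sub0r pieceB // zero_in_piece.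
Qed.

Lemma decomposition_widen v N c k :
  decomposition v N c -> decomposition v (N + k) c.
Proof.
move=> [cV c0 vE]; split=> // [i Ni|]; first by rewrite c0 // (leq_trans (leq_addr _ _) Ni).
by rewrite big_split_ord /= [X in _ + X]big1 ?addr0 // => i _; rewrite c0 ?leq_addr.
Qed.

Lemma decomposition_uniq v N c N' c' :
  decomposition v N c -> decomposition v N' c' -> c = c'.
Proof.
move=> /(decomposition_widen N') [cV c0 vE].
move=> /(decomposition_widen N) []; rewrite addnC => c'V c'0 vE'.
apply/funext => i; have [le_i|lt_i] := leqP (N + N') i; first by rewrite c0 ?c'0.
case: sumV => _ _ /(_ (N + N')%N (fun i => c i - c' i)) uniq.
apply/eqP; rewrite -subr_eq0; apply/eqP/uniq => // [j|]; first exact: pieceB.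
by rewrite sumrB -vE -vE' subrr.
Qed.

Lemma decomposition_exists v : exists N c, decomposition v N c.
Proof.
case: sumV => _ /(_ v)[N [c [cV vE]]] _.
exists N, (fun i => if (i < N)%N then c i else 0); split.
- by move=> i; case: ifP => // _; apply: zero_in_piece.
- by move=> i; rewrite ltnNge => ->.
- by rewrite vE; apply: eq_bigr => i _; rewrite ltn_ord.
Qed.

Definition component n v : V :=
  projT1 (cid (projT2 (cid (decomposition_exists v)))) n.

Lemma componentP v : exists N, decomposition v N (component^~ v).
Proof. by rewrite /component; case: cid => N /= ?; case: cid => c /= ?; exists N. Qed.

Lemma componentE v N c n : decomposition v N c -> component n v = c n.
Proof. by have [N' dv] := componentP v => /(decomposition_uniq dv) /= <-. Qed.

Lemma component_in n v : component n v \in V_ n.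
Proof. by have [N []] := componentP v. Qed.

Lemma component_homog n k v :
  v \in V_ n -> component k v = if k == n then v else 0.
Proof.
move=> vn; apply: (@componentE _ n.+1 (fun k => if k == n then v else 0)); split.
- by move=> i; case: eqP => [->//|_]; apply: zero_in_piece.
- by move=> i ni; rewrite gtn_eqF.
- rewrite big_ord_recr /= eqxx big1 ?add0r // => i _.
  by rewrite ltn_eqF.
Qed.

Lemma componentD n u v : component n (u + v) = component n u + component n v.
Proof.
have [N /(decomposition_widen)] := componentP u => du.
have [N' /(decomposition_widen)] := componentP v => dv.
have [du1 du2 du3] := du N'; have := dv N; rewrite addnC => -[dv1 dv2 dv3].
apply: (@componentE _ (N + N') (fun n => component n u + component n v)); split.
- by move=> i; apply: pieceD.
- by move=> i Ni; rewrite du2 // dv2 // addr0.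
- by rewrite big_split /= -du3 -dv3.
Qed.

Lemma component0 n : component n 0 = 0.
Proof. by rewrite (component_homog _ (zero_in_piece n)) if_same. Qed.

Lemma component_sum n (I : Type) (r : seq I) (f : I -> V) :
  component n (\sum_(i <- r) f i) = \sum_(i <- r) component n (f i).
Proof. exact: (big_morph _ (componentD n) (component0 n)). Qed.

Lemma componentB n u v : component n (u - v) = component n u - component n v.
Proof. by apply/eqP; rewrite eq_sym subr_eq -componentD subrK. Qed.

End DirectSum.

(** A map of degree [e] carries the decomposition of [v] to that of [f v], shifted by [e]. It serves
    with [e = 1] for multiplication by elements of [S] and with [e = 0] for scalars. *)
Lemma component_shift (V V' : zmodType) (V_ : nat -> {pred V})
    (V'_ : nat -> {pred V'}) (sumV : is_direct_sum V_)
    (sumV' : is_direct_sum V'_) (e : nat) (f : V -> V') :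
  {morph f : x y / x + y} ->
  (forall i v, v \in V_ i -> f v \in V'_ (e + i)%N) ->
  forall n v, component sumV' n (f v) =
    if (e <= n)%N then f (component sumV (n - e)%N v) else 0.
Proof.
move=> fD fV n v; have [N [cV c0 vE]] := componentP sumV v.
have f0 : f 0 = 0 by apply: (addrI (f 0)); rewrite -fD !addr0.
rewrite {1}vE (big_morph _ fD f0) component_sum.
under eq_bigr do rewrite (component_homog _ _ (fV _ _ (cV _))).
case: leqP => en; last first.
  by rewrite big1 // => i _; rewrite ltn_eqF // ltn_addr.
have [Nn|nN] := leqP N (n - e).
  rewrite c0 // f0 big1 // => i _.
  by rewrite gtn_eqF // -ltn_subRL (leq_trans (ltn_ord i)).
rewrite (bigD1 (Ordinal nN)) //= subnKC // eqxx big1 ?addr0 // => i /eqP ni.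
case: eqP => // nE; case: ni; apply: val_inj => /=.
by rewrite nE addKn.
Qed.

(** * Restriction of scalars along [eta] *)

(** An alias of [M], so that its structure of [F]-vector space does not compete with that of
    [R]-module. *)
Definition restriction_of_scalars (F : fieldType) (R : pzRingType)
  (eta : {rmorphism F -> R}) (M : lmodType R) : Type := M.

Section RestrictionOfScalars.
Variables (F : fieldType) (R : pzRingType) (eta : {rmorphism F -> R}).
Variable M : lmodType R.
Notation M' := (restriction_of_scalars eta M).

HB.instance Definition _ := GRing.Zmodule.copy M' M.

Definition restricted_scale (k : F) (m : M') : M' := eta k *: (m : M).

Lemma restricted_scaleA a b m :
  restricted_scale a (restricted_scale b m) = restricted_scale (a * b) m.
Proof. by rewrite /restricted_scale scalerA rmorphM. Qed.

Lemma restricted_scale1 : left_id 1 restricted_scale.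
Proof. by move=> m; rewrite /restricted_scale rmorph1 scale1r. Qed.

Lemma restricted_scaleDr : right_distributive restricted_scale +%R.
Proof. by move=> k m n; rewrite /restricted_scale scalerDr. Qed.

Lemma restricted_scaleDl m : {morph restricted_scale^~ m : a b / a + b}.
Proof. by move=> a b; rewrite /restricted_scale rmorphD scalerDl. Qed.

HB.instance Definition _ := GRing.Zmodule_isLmodule.Build F M'
  restricted_scaleA restricted_scale1 restricted_scaleDr restricted_scaleDl.

End RestrictionOfScalars.

(** * Graded submodules over a good algebra *)

Section Hilbert.
Variables (F : fieldType) (R : pzRingType) (eta : {rmorphism F -> R}).
Variables (R_ : nat -> {pred R}) (S : {fset R}).
Hypothesis R_good : good_algebra eta R_ S.
Variables (M : lmodType R) (M_ : nat -> {pred M}).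
Hypotheses (M_graded : graded_module R_ M_) (M_fg : finitely_generated M).

Let R_graded := good_graded R_good.
Let sumR := graded_algebra_sum R_graded.
Let sumM := graded_module_sum M_graded.
Notation M' := (restriction_of_scalars eta M).

Lemma eta_degree0 k : eta k \in R_ 0%N.
Proof.
rewrite -[eta k]mulr1; apply: (graded_algebra_scale R_graded).
exact: graded_algebra1 R_graded.
Qed.

(** The factor given by [sR = Rs] need not be homogeneous. Since [s * r] has degree [i + 1],
    comparing components of that degree shows that its component of degree [i] works too. *)
Lemma normal_left i s r : s \in S -> r \in R_ i ->
  exists2 r', r' \in R_ i & s * r = r' * s.
Proof.
move=> Ss Rr; have : range (fun r : R => s * r) (s * r) by exists r.
rewrite (good_normal R_good Ss) => -[r' _ r'E].
exists (component sumR i r'); first exact: component_in.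
have <- : component sumR i.+1 (r' * s) = component sumR i r' * s.
  rewrite (component_shift (e := 1) sumR sumR (f := *%R^~ s)) ?subSS ?subn0 //.
  - by move=> x y; rewrite mulrDl.
  - move=> j x Rx; rewrite addnC.
    exact: (graded_algebraM R_graded) Rx (good_degree1 R_good Ss).
have Rsr := graded_algebraM R_graded (good_degree1 R_good Ss) Rr.
by rewrite r'E (component_homog sumR _ Rsr) eqxx.
Qed.

Lemma normal_right i s r : s \in S -> r \in R_ i ->
  exists2 r', r' \in R_ i & r * s = s * r'.
Proof.
move=> Ss Rr; have : range (fun r : R => r * s) (r * s) by exists r.
rewrite -(good_normal R_good Ss) => -[r' _ r'E].
exists (component sumR i r'); first exact: component_in.
have <- : component sumR i.+1 (s * r') = s * component sumR i r'.
  rewrite (component_shift (e := 1) sumR sumR (f := *%R s)) ?subSS ?subn0 //.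
  - by move=> x y; rewrite mulrDr.
  - by move=> j x Rx; apply: (graded_algebraM R_graded) (good_degree1 R_good Ss) Rx.
have Rrs := graded_algebraM R_graded Rr (good_degree1 R_good Ss).
by rewrite r'E (component_homog sumR _ Rrs) addn1 eqxx.
Qed.

(* A graded submodule of M is encoded by the family of its pieces. *)
Record graded_submodule (L : nat -> set M) : Prop := GradedSubmodule {
  graded_submodule_sub : forall n m, L n m -> m \in M_ n;
  graded_submodule0 : forall n, L n 0;
  graded_submoduleD : forall n u v, L n u -> L n v -> L n (u + v);
  graded_submoduleZ : forall i j r m, r \in R_ i -> L j m -> L (i + j)%N (r *: m)
}.

Lemma submodule_piece L n : graded_submodule L -> submodule (L n : set M').
Proof.
move=> gL; split; first exact: graded_submodule0.
move=> k u v Lu Lv; apply: graded_submoduleD => //.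
exact: graded_submoduleZ (eta_degree0 k) Lu.
Qed.

Lemma graded_submodule_full : graded_submodule (fun n => [set m | m \in M_ n]).
Proof.
split=> //= [n|n u v|]; [exact: zero_in_piece|exact: pieceD|exact: graded_moduleZ].
Qed.

Lemma graded_submodule_zero : graded_submodule (fun=> [set 0]).
Proof.
split=> //= [n _ ->|n _ _ -> ->|i j r _ _ ->]; rewrite ?addr0 ?scaler0 //.
exact: zero_in_piece.
Qed.

Lemma graded_submodule_sumset L N : graded_submodule L -> graded_submodule N ->
  graded_submodule (fun n => sumset (L n) (N n)).
Proof.
move=> gL gN; split=> [n _ [u [v [Lu Nv ->]]]|n|n _ _ [u [v [Lu Nv ->]]]
  [u' [v' [Lu' Nv' ->]]]|i j r _ Rr [u [v [Lu Nv ->]]]].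
- by apply: pieceD => //; [exact: (graded_submodule_sub gL)|exact: (graded_submodule_sub gN)].
- by exists 0, 0; rewrite addr0; split=> //; apply: graded_submodule0.
- by exists (u + u'), (v + v'); rewrite addrACA; split=> //; apply: graded_submoduleD.
- by exists (r *: u), (r *: v); rewrite scalerDr; split=> //; apply: graded_submoduleZ.
Qed.

(** The submodule [sL]; nothing is left in degree 0 because [s] raises degrees by one. *)
Definition graded_image s (L : nat -> set M) n : set M :=
  if n is n'.+1 then *:%R s @` L n' else [set 0].

Lemma graded_submodule_image s L : s \in S -> graded_submodule L ->
  graded_submodule (graded_image s L).
Proof.
move=> Ss gL; split=> [[|n] m /=|[|n] //=|[|n] u v /=|i [|n] r m Rr /=].
- by move=> ->; apply: zero_in_piece.
- move=> [u Lu <-]; apply: (graded_moduleZ M_graded) (good_degree1 R_good Ss) _.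
  exact: graded_submodule_sub Lu.
- by exists 0; rewrite ?scaler0 //; apply: graded_submodule0.
- by move=> -> ->; rewrite addr0.
- move=> [x Lx <-] [y Ly <-]; exists (x + y); rewrite ?scalerDr //.
  exact: graded_submoduleD.
- move=> ->; rewrite scaler0 addn0; case: i {Rr} => //= i.
  by exists 0; rewrite ?scaler0 //; apply: graded_submodule0.
- move=> [x Lx <-]; rewrite addnS /=.
  (* Stability under [R]: [r (s x) = s (r' x)]. *)
  have [r' Rr' rE] := normal_right Ss Rr.
  by exists (r' *: x); rewrite ?scalerA ?rE //; apply: graded_submoduleZ.
Qed.

(** Modulo [N], when [N] is a graded submodule of [L], this is the kernel of multiplication by [s]
    on [L / N]. *)
Definition graded_colon s (L N : nat -> set M) n : set M :=
  [set m | L n m /\ N n.+1 (s *: m)].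

Lemma graded_submodule_colon s L N : s \in S -> graded_submodule L ->
  graded_submodule N -> graded_submodule (graded_colon s L N).
Proof.
move=> Ss gL gN; split=> [n m []|n|n u v [Lu Nu] [Lv Nv]|i j r m Rr [Lm Nm]].
- by move=> /(graded_submodule_sub gL).
- by split; rewrite ?scaler0; apply: graded_submodule0.
- by split; rewrite ?scalerDr; apply: graded_submoduleD.
- split; first exact: graded_submoduleZ.
  (* Stability under [R]: [s (r m) = r' (s m)]. *)
  have [r' Rr' rE] := normal_left Ss Rr.
  by rewrite scalerA rE -scalerA -addnS; apply: graded_submoduleZ.
Qed.

(** The pieces assembled into one ungraded submodule, to which the Noetherian property of [R] can be
    applied. *)
Definition total (L : nat -> set M) : set M :=
  [set m | forall n, L n (component sumM n m)].

Lemma submodule_total L : graded_submodule L -> submodule (total L).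
Proof.
move=> gL; split=> [n|r u v Lu Lv n].
  by rewrite component0; apply: graded_submodule0.
rewrite componentD; apply: graded_submoduleD => //.
have [N [_ _ ->]] := componentP sumM u; have [N' [_ _ ->]] := componentP sumR r.
have Lsum I s (f : I -> M) : (forall i, L n (f i)) -> L n (\sum_(i <- s) f i).
  move=> Lf; apply: big_ind => [|x y|i _]; [exact: graded_submodule0| |exact: Lf].
  exact: graded_submoduleD.
rewrite scaler_suml component_sum; apply: (Lsum) => i.
rewrite scaler_sumr component_sum; apply: Lsum => j.
have Lij := graded_submoduleZ gL (component_in sumR i r) (Lu j).
rewrite (component_homog sumM _ (graded_submodule_sub gL Lij)).
by case: eqP => [->//|_]; apply: graded_submodule0.
Qed.

Lemma total_homog L n m : graded_submodule L -> L n m -> total L m.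
Proof.
move=> gL Lm k; rewrite (component_homog sumM _ (graded_submodule_sub gL Lm)).
by case: eqP => [->//|_]; apply: graded_submodule0.
Qed.

(** * Subquotients annihilated by all of [S] *)

(** The elements of [R] that act on [L / N] as scalars of [F] form a subalgebra. It contains [S],
    whose elements act as 0, so it is all of [R]. *)
Lemma scalar_action L N : graded_submodule L -> graded_submodule N ->
  (forall n m, N n m -> L n m) ->
  (forall s n m, s \in S -> L n m -> N n.+1 (s *: m)) ->
  forall r, exists k, forall m, total L m -> total N (r *: m - eta k *: m).
Proof.
move=> gL gN NL SLN.
have sL := submodule_total gL; have sN := submodule_total gN.
pose A : {pred R} := fun r => `[< exists k, forall m, total L m -> total N (r *: m - eta k *: m) >].
have tNL m : total N m -> total L m by move=> Nm n; apply/NL/Nm.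
move=> r; apply/asboolP; apply: (good_generates R_good (A := A)).
- split; rewrite ?unfold_in.
  + apply/asboolP; exists 1 => m _; rewrite rmorph1 subrr; by case: sN.
  + move=> x y; rewrite !unfold_in => /asboolP[k kP] /asboolP[l lP].
    apply/asboolP; exists (k - l) => m Lm.
    have -> : (x - y) *: m - eta (k - l) *: m
        = (x *: m - eta k *: m) - (y *: m - eta l *: m).
      by rewrite rmorphB /= !scalerBl !opprB addrACA [RHS]addrACA; congr (_ + _); rewrite addrC.
    by apply: (submoduleB sN); [exact: kP|exact: lP].
  + move=> x y; rewrite !unfold_in => /asboolP[k kP] /asboolP[l lP].
    apply/asboolP; exists (k * l) => m Lm.
    have -> : (x * y) *: m - eta (k * l) *: m
        = x *: (y *: m - eta l *: m) + (x *: (eta l *: m) - eta k *: (eta l *: m)).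
      by rewrite rmorphM /= scalerBr !scalerA addrA subrK.
    apply: (submoduleD sN); first by apply: (submoduleZ _ sN); exact: lP.
    by apply: kP; apply: (submoduleZ _ sL).
- move=> k; rewrite unfold_in; apply/asboolP; exists k => m _.
  by rewrite subrr; case: sN.
- move=> s Ss; rewrite unfold_in; apply/asboolP; exists 0 => m Lm n.
  rewrite rmorph0 scale0r subr0.
  rewrite (component_shift (e := 1) sumM sumM (f := *:%R s)).
  + by case: n => [|n]; [exact: graded_submodule0|rewrite subSS subn0; apply: SLN].
  + by move=> u v; rewrite scalerDr.
  + by move=> i v Mv; apply: (graded_moduleZ M_graded) (good_degree1 R_good Ss) Mv.
Qed.

(* [L / N] has finite-dimensional pieces and a Hilbert polynomial of size at
   most [k]. *)
Definition hilbert_polynomial N L k :=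
  (forall n, exists d, rdim (N n : set M') (L n) d) /\
  exists P : {poly rat}, [/\ integer_valued P, (size P <= k)%N &
    exists n0, forall n d, (n0 <= n)%N ->
      rdim (N n : set M') (L n) d -> d%:R = P.[n%:R]].

(** [L] is finitely generated over [R], which acts on [L / N] through [F]. So components of finitely
    many generators span each piece over [F], and they vanish in large degrees: the polynomial is
    0. *)
Lemma hilbert_polynomial_annihilated L N :
  graded_submodule L -> graded_submodule N -> (forall n m, N n m -> L n m) ->
  (forall s n m, s \in S -> L n m -> N n.+1 (s *: m)) ->
  hilbert_polynomial N L 0.
Proof.
move=> gL gN NL SLN.
have sL := submodule_total gL; have sN := submodule_total gN.
have [g0 Mg0] := M_fg.
have [g [gL' Lg]] := submodule_span_fg (good_noetherian R_good) sL (fun m _ => Mg0 m).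
have [k kP] := choice (scalar_action gL gN NL SLN).
(* Write [m] through the generators over [R], replace each coefficient by the scalar it acts as, and
   take components of degree [n]. *)
have gspan n m : L n m -> exists a : nat -> F,
    N n (m - \sum_(i < size g) eta (a i) *: component sumM n g`_i).
  move=> Lm; have [a mE] := Lg _ (total_homog gL Lm).
  exists (k \o a).
  have {mE} : total N (m - \sum_(i < size g) eta (k (a i)) *: g`_i).
    rewrite mE -sumrB; apply: (submodule_sum sN) => i _.
    by apply: kP; apply/gL'/mem_nth.
  move=> /(_ n); rewrite componentB component_sum.
  rewrite (component_homog sumM _ (graded_submodule_sub gL Lm)) eqxx.
  congr (N n (_ - _)); apply: eq_bigr => i _ /=.
  rewrite (component_shift (e := 0) sumM sumM (f := *:%R (eta _))) ?subn0 //.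
  - by move=> u v; rewrite scalerDr.
  - by move=> j v; apply: (graded_moduleZ M_graded) (eta_degree0 _).
split=> [n|].
  apply: (@rdim_fg _ M' _ _ [seq component sumM n x | x <- g]).
  - exact: submodule_piece.
  - exact: submodule_piece.
  - exact: NL.
  - by move=> _ /mapP[x gx ->]; apply: gL'.
  move=> m /gspan[a Nm].
  exists (m - \sum_(i < size g) eta (a i) *: component sumM n g`_i),
    (\sum_(i < size g) eta (a i) *: component sumM n g`_i).
  rewrite subrK; split=> //; exists a.
  rewrite size_map; apply: eq_bigr => i _.
  by rewrite (nth_map 0).
have [n0 n0P] : exists n0, forall n x, (n0 <= n)%N -> x \in g -> component sumM n x = 0.
  elim: g {gL' Lg gspan} => [|x g [n0 IH]]; first by exists 0%N.
  have [n1 [_ n1P _]] := componentP sumM x.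
  exists (n0 + n1)%N => n y le_n; rewrite inE => /orP[/eqP->|].
    by apply: n1P; apply: leq_trans le_n; rewrite leq_addl.
  by apply: IH; apply: leq_trans le_n; rewrite leq_addr.
exists 0; split; rewrite ?size_poly0 //; first by move=> z; rewrite horner0 rpred0.
exists n0 => n d le_n Ld; rewrite horner0.
suff -> : d = 0%N by [].
apply: rdim_uniq Ld _; first exact: submodule_piece.
rewrite (_ : L n = N n); first exact: rdim_refl.
apply/seteqP; split=> m; last exact: NL.
move=> /gspan[a]; rewrite big1 ?subr0 // => i _.
by rewrite n0P ?scaler0 // mem_nth.
Qed.

(** * The induction on the elements of [S] *)

(** [T] lists the elements of [S] that are allowed not to annihilate [L / N]; its length bounds the
    size of the polynomial. *)
Lemma hilbert_polynomial_exists (T : seq R) L N :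
  (forall t, t \in T -> t \in S) ->
  graded_submodule L -> graded_submodule N -> (forall n m, N n m -> L n m) ->
  (forall s n m, s \in S -> s \notin T -> L n m -> N n.+1 (s *: m)) ->
  hilbert_polynomial N L (size T).
Proof.
elim: T L N => [|s T IH] L N TS gL gN NL LN.
  by apply: hilbert_polynomial_annihilated => // s n m Ss; apply: LN.
have Ss : s \in S by apply: TS; rewrite inE eqxx.
have {}TS t : t \in T -> t \in S by move=> tT; apply: TS; rewrite inE tT orbT.
(* [K / N] and [L / N'] are the kernel and cokernel of [s] on [L / N]. Both are annihilated by [s],
   so the induction hypothesis applies to them with [s] dropped from the list. *)
pose K := graded_colon s L N; pose N' n := sumset (N n) (graded_image s L n).
have gK : graded_submodule K by apply: graded_submodule_colon.
have gI := graded_submodule_image Ss gL.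
have gN' : graded_submodule N' by apply: graded_submodule_sumset.
have s1 := good_degree1 R_good Ss.
have NN' n m : N n m -> N' n m by apply: sumsetl; exact: (graded_submodule0 gI).
have N'L n m : N' n m -> L n m.
  move=> [u [v [/NL Lu sv ->]]]; apply: graded_submoduleD => //.
  case: n sv {Lu} => [|n] /= => [->|[w Lw <-]]; first exact: graded_submodule0.
  exact: graded_submoduleZ s1 Lw.
have NK n m : N n m -> K n m.
  by move=> Nm; split; [exact: NL|exact: graded_submoduleZ s1 Nm].
have [eK [PK [PKint PKsize [nK PKE]]]] : hilbert_polynomial N K (size T).
  apply: IH => // t n m St tT [Lm Nsm]; have [->//|ts] := eqVneq t s.
  by apply: LN; rewrite // inE negb_or ts.
have [fC [PC [PCint PCsize [nC PCE]]]] : hilbert_polynomial N' L (size T).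
  apply: IH => // t n m St tT Lm; have [->|ts] := eqVneq t s.
    by apply: sumsetr; [exact: graded_submodule0|exists m].
  by apply: NN'; apply: LN; rewrite // inE negb_or ts.
have sub := submodule_piece.
(* The exact sequence in dimensions: with [c] the dimension of [L n / K n], also that of
   [N' n.+1 / N n.+1], one has [d = e + c] and [d' = c + f]. The sum form avoids truncated
   subtraction. *)
have step n d : rdim (N n : set M') (L n) d -> forall e f, rdim (N n : set M') (K n) e ->
    rdim (N' n.+1 : set M') (L n.+1) f ->
    exists2 d', rdim (N n.+1 : set M') (L n.+1) d' & (d' + e = d + f)%N.
  move=> Ld e f Ke Lf.
  have KL m : K n m -> L n m by case.
  have [c Lc] := rdim_quotient (sub _ n gN) (sub _ n gK) (sub _ n gL) (@NK n) KL Ld.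
  have <- := rdim_uniq (sub _ n gN) (rdim_trans (sub _ n gK) (@NK n) KL Ke Lc) Ld.
  exists (c + f)%N; last by rewrite addnC addnA.
  apply: rdim_trans (sub _ _ gN') (@NN' n.+1) (@N'L n.+1) _ Lf.
  pose fs : M' -> M' := *:%R s.
  (* Multiplication by [s] is [F]-linear because the image of [eta] is central. *)
  have fs_lin : linear fs.
    move=> k u v; rewrite /fs scalerDr; congr (_ + _).
    rewrite [LHS]scalerA -(graded_algebra_alg R_graded k s).
    by rewrite -[LHS]scalerA.
  pose fL : {linear M' -> M'} := HB.pack fs (GRing.isLinear.Build _ _ _ _ fs fs_lin).
  exact: (@rdim_image _ _ fL (L n) (N n.+1) c (sub _ _ gN) Lc (sub _ _ gL)).
(* In degree 0 the image of [s] is zero, so [N'] and [N] agree there; [step] then climbs one degree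
   at a time. *)
have fin n : exists d, rdim (N n : set M') (L n) d.
  elim: n => [|n [d Ld]].
    have [f Lf] := fC 0%N; exists f; rewrite (_ : N 0%N = N' 0%N) //.
    apply/seteqP; split=> m; first exact: NN'.
    by move=> [u [_ [Nu -> ->]]]; rewrite addr0.
  have [e Ke] := eK n; have [f Lf] := fC n.+1.
  by have [d'] := step _ _ Ld _ _ Ke Lf; exists d'.
have [d dP] := choice fin; have [e eP] := choice eK; have [f fP] := choice fC.
split; first exact: fin.
(* The shift in [PC] reflects that the cokernel is taken in degree [n + 1] and the kernel in degree
   [n]. *)
pose Q := PC \Po ('X + 1) - PK.
have QE x : Q.[x] = PC.[x + 1] - PK.[x].
  by rewrite hornerD hornerN horner_comp; congr (PC.[_] - _); rewrite !hornerE.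
have [|||P [Pint Psize PE]] := @poly_summation (size T) Q d (nK + nC).
- by move=> z; rewrite QE rpredB ?PKint //; have := PCint (z + 1); rewrite rmorphD.
- rewrite (leq_trans (size_polyD _ _)) // geq_max size_polyN PKsize andbT.
  by rewrite size_comp_poly2 // -polyC1 size_XaddC.
- move=> n le_n; have [d' Ld' d'E] := step _ _ (dP n) _ _ (eP n) (fP n.+1).
  rewrite (rdim_uniq (sub _ _ gN) (dP n.+1) Ld') QE natr1.
  rewrite -(PCE _ _ _ (fP n.+1)); last first.
    by rewrite (leq_trans _ (leqW le_n)) ?leq_addl.
  rewrite -(PKE _ _ _ (eP n)) ?(leq_trans _ le_n) ?leq_addr //.
  by rewrite addrA -natrD -d'E natrD addrK.
exists P; split=> //; exists (nK + nC)%N => n c le_n Lc.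
by rewrite (rdim_uniq (sub _ _ gN) Lc (dP n)) PE.
Qed.

End Hilbert.

(* The field of complex numbers is K[i], with K the real numbers;
   size P <= #|` S| says that deg P < |S|, the zero polynomial having size 0
   and hence degree < 0. *)
Theorem proposition3p36 (K : realType) (R : pzRingType)
    (eta : {rmorphism K[i] -> R}) (R_ : nat -> {pred R}) (S : {fset R})
    (R_good : good_algebra eta R_ S)
    (M : lmodType R) (M_ : nat -> {pred M})
    (M_graded : graded_module R_ M_) (M_fg : finitely_generated M) :
  exists P : {poly rat},
    [/\ integer_valued P,
        (size P <= #|` S|)%N
      & exists N : nat, forall n : nat, (N <= n)%N ->
          exists2 d : nat, has_dim eta (M_ n) d & d%:R = P.[n%:R]].
Proof.
(* Take [L = M], [N = 0] and all of [S] for [T]: the annihilation hypothesis becomes vacuous. *)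
have [|||dimM [P [Pint Psize [n0 PE]]]] := hilbert_polynomial_exists R_good M_graded M_fg
  (T := enum_fset S) _ (graded_submodule_full M_graded) (graded_submodule_zero M_graded).
- by [].
- by move=> n _ ->; apply: zero_in_piece (graded_module_sum M_graded) n.
- by move=> s n m Ss /negP.
exists P; split=> //; exists n0 => n le_n; have [d dM] := dimM n.
exists d; last exact: PE dM.
have [b [bM bI bS]] := dM; exists b; split=> // m /bS[k kE].
by exists k; apply/eqP; rewrite -subr_eq0; apply/eqP.
Qed.
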